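(* Let $m,n \geq 2$ be integers, and let $T_{m,n} = \langle a, b \mid a^m b^n = 1\rangle$. Then $T_{m,n}$ has an index $mn$ characteristic subgroup isomorphic to the right-angled Artin group $\mathbb{Z} \times F_{(m-1)(n-1)}$.
   Context: $\langle A \mid R\rangle$ denotes the group presented by generators $A$ and defining relations $R$. $F_r$ denotes the free group of rank $r$. *)

(* Defs.v *)
From HB Require Import structures.
From mathcomp Require Import all_boot ssralg ssrint.
From mathcomp Require Import generic_quotient boolp classical_sets cardinality.

Set Implicit Arguments.
Unset Strict Implicit.
Unset Printing Implicit Defensive.

Local Open Scope classical_set_scope.
Local Open Scope card_scope.
Local Open Scope group_scope.

(* Words in the letters x and x^-1, for x : A: the pair (x, false) stands for
   the letter x, and (x, true) for x^-1. *)
Notation word A := (seq (A * bool)).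

Definition letter (A : Type) (x : A) : A * bool := (x, false).
Definition flip_letter (A : Type) (l : A * bool) : A * bool := (l.1, ~~ l.2).
Definition inv_word (A : Type) (w : word A) : word A :=
  rev (map (@flip_letter A) w).

Section Presentation.
Variable A : choiceType.

(* R u v means that u = v is one of the defining relations. *)
Implicit Type R : word A -> word A -> Prop.

Inductive word_equiv R : word A -> word A -> Prop :=
| word_equiv_refl w : word_equiv R w w
| word_equiv_sym u v : word_equiv R u v -> word_equiv R v u
| word_equiv_trans u v w :
    word_equiv R u v -> word_equiv R v w -> word_equiv R u w
| word_equiv_cancel u l v :
    word_equiv R (u ++ [:: l; flip_letter l] ++ v) (u ++ v)
| word_equiv_relation u r s v :
    R r s -> word_equiv R (u ++ r ++ v) (u ++ s ++ v).

Definition word_equivb R : rel (word A) := fun u v => `[< word_equiv R u v >].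

Lemma word_equivb_is_equiv R : equiv_class_of (word_equivb R).
Proof.
split=> [w|u v|v u w].
- exact/asboolP/word_equiv_refl.
- by apply/asboolP/asboolP; apply: word_equiv_sym.
- by move=> /asboolP uv /asboolP vw; apply/asboolP/(word_equiv_trans uv).
Qed.

Canonical word_equivb_rel R := EquivRelPack (word_equivb_is_equiv R).

(* The group < A | R >. *)
Definition presented R : Type := {eq_quot word_equivb_rel R}%qT.

HB.instance Definition _ R := Choice.on (presented R).

Definition word_class R (w : word A) : presented R :=
  (\pi_({eq_quot word_equivb_rel R}) w)%qT.

Lemma word_classP R u v : word_class R u = word_class R v <-> word_equiv R u v.
Proof.
split=> [/eqP|uv].
  by rewrite /word_class eqmodE => /asboolP.
by apply/eqP; rewrite /word_class eqmodE; apply/asboolP.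
Qed.

Definition word_rep R (x : presented R) : word A :=
  repr (x : {eq_quot word_equivb_rel R}%qT).

Lemma word_repK R : cancel (@word_rep R) (word_class R).
Proof. exact: reprK. Qed.

Lemma word_equiv_rep R w : word_equiv R (word_rep (word_class R w)) w.
Proof. by apply/word_classP; rewrite word_repK. Qed.

Lemma word_equiv_cat R u u' v v' :
  word_equiv R u u' -> word_equiv R v v' -> word_equiv R (u ++ v) (u' ++ v').
Proof.
have catl p a b : word_equiv R a b -> word_equiv R (p ++ a) (p ++ b).
  elim=> [w|? ? _|? ? ? _ + _|x l y|x r s y].
  - exact: word_equiv_refl.
  - exact: word_equiv_sym.
  - exact: word_equiv_trans.
  - by rewrite !(catA p); apply: word_equiv_cancel.
  - by rewrite !(catA p); apply: word_equiv_relation.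
have catr p a b : word_equiv R a b -> word_equiv R (a ++ p) (b ++ p).
  elim=> [w|? ? _|? ? ? _ + _|x l y|x r s y].
  - exact: word_equiv_refl.
  - exact: word_equiv_sym.
  - exact: word_equiv_trans.
  - by rewrite -!catA; apply: word_equiv_cancel.
  - by rewrite -!catA; apply: word_equiv_relation.
by move=> uu' vv'; apply: word_equiv_trans (catr _ _ _ uu') (catl _ _ _ vv').
Qed.

Lemma word_equiv_catV R w : word_equiv R (w ++ inv_word w) [::].
Proof.
elim: w => [|l w IHw]; first exact: word_equiv_refl.
have -> : (l :: w) ++ inv_word (l :: w) =
    [:: l] ++ (w ++ inv_word w) ++ [:: flip_letter l].
  by rewrite /inv_word /= rev_cons -cats1 !catA.
apply: word_equiv_trans (word_equiv_cancel R [::] l [::]).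
rewrite -[X in word_equiv _ _ X]/([:: l] ++ [::] ++ [:: flip_letter l]).
apply: word_equiv_cat (word_equiv_refl _ _) _.
exact: word_equiv_cat IHw (word_equiv_refl _ _).
Qed.

Lemma inv_wordK : involutive (@inv_word A).
Proof.
move=> w; rewrite /inv_word map_rev revK -map_comp map_id_in// => -[x b] _ /=.
by rewrite /flip_letter /= negbK.
Qed.

Definition presented_one R : presented R := word_class R [::].
Definition presented_mul R (x y : presented R) : presented R :=
  word_class R (word_rep x ++ word_rep y).
Definition presented_inv R (x : presented R) : presented R :=
  word_class R (inv_word (word_rep x)).

Lemma presented_mulA R : associative (@presented_mul R).
Proof.
move=> x y z; apply/word_classP.
apply: (@word_equiv_trans _ _ (word_rep x ++ word_rep y ++ word_rep z)).
  exact: word_equiv_cat (word_equiv_refl _ _) (word_equiv_rep _ _).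
rewrite catA; apply: word_equiv_sym.
exact: word_equiv_cat (word_equiv_rep _ _) (word_equiv_refl _ _).
Qed.

Lemma presented_mul1 R : left_id (presented_one R) (@presented_mul R).
Proof.
move=> x; rewrite -[RHS]word_repK; apply/word_classP.
exact: word_equiv_cat (word_equiv_rep _ [::]) (word_equiv_refl _ _).
Qed.

Lemma presented_mulr1 R : right_id (presented_one R) (@presented_mul R).
Proof.
move=> x; rewrite -[RHS]word_repK; apply/word_classP.
rewrite -[X in word_equiv _ _ X]cats0.
exact: word_equiv_cat (word_equiv_refl _ _) (word_equiv_rep _ [::]).
Qed.

Lemma presented_mulV R :
  left_inverse (presented_one R) (@presented_inv R) (@presented_mul R).
Proof.
move=> x; apply/word_classP.
apply: word_equiv_trans
  (word_equiv_cat (word_equiv_rep _ _) (word_equiv_refl _ _)) _.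
by rewrite -[X in _ ++ X]inv_wordK; apply: word_equiv_catV.
Qed.

Lemma presented_mulrV R :
  right_inverse (presented_one R) (@presented_inv R) (@presented_mul R).
Proof.
move=> x; apply/word_classP.
apply: word_equiv_trans
  (word_equiv_cat (word_equiv_refl _ _) (word_equiv_rep _ _)) _.
exact: word_equiv_catV.
Qed.

HB.instance Definition _ R := isGroup.Build (presented R)
  (@presented_mulA R) (@presented_mul1 R) (@presented_mulr1 R)
  (@presented_mulV R) (@presented_mulrV R).

End Presentation.

Definition free_group (r : nat) : groupType :=
  presented (fun _ _ : word 'I_r => False).

(* T_group m n = < a, b | a^m b^n = 1 >, with a and b indexed by 0 and 1 in 'I_2. *)
Definition T_group (m n : nat) : groupType :=
  let a := letter (ord0 : 'I_2) in
  let b := letter (ord_max : 'I_2) in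
  presented (fun u v : word 'I_2 => u = nseq m a ++ nseq n b /\ v = [::]).

(* The right-angled Artin group of the graph with adjacency relation e:
   x y = y x for all adjacent x and y. *)
Definition right_angled_Artin (V : finType) (e : rel V) : groupType :=
  presented (fun u v : word V => exists x y : V,
    [/\ e x y, u = [:: letter x; letter y] & v = [:: letter y; letter x]]).

(* The additive group of integers, written multiplicatively. *)
Definition Zgroup : Type := int.
HB.instance Definition _ := Choice.on Zgroup.
HB.instance Definition _ := @isGroup.Build Zgroup 0%R (@GRing.opp int)
  (@GRing.add int) (@GRing.addrA int) (@GRing.add0r int) (@GRing.addr0 int)
  (@GRing.addNr int) (@GRing.addrN int).

(* A subgroup of G is a H : groupClosed G; its carrier is the following type. *)
Definition subgroup_type (G : groupType) (H : groupClosed G) : Type :=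
  {x : G | x \in H}.

Section SubgroupType.
Variables (G : groupType) (H : groupClosed G).

HB.instance Definition _ := SubChoice.on (subgroup_type H).

Lemma groupClosed_group_closed : group_closed (fun x : G => x \in H).
Proof. by split=> [|x y]; [apply: gpred1 | apply: gpredF]. Qed.

HB.instance Definition _ := SubChoice_isSubGroup.Build
  G (fun x : G => x \in H) (subgroup_type H) groupClosed_group_closed.

End SubgroupType.

Definition isomorphic (G H : groupType) : Prop :=
  exists f : {multiplicative G -> H}, bijective f.

Definition characteristic (G : groupType) (H : groupClosed G) : Prop :=
  forall f : {multiplicative G -> G}, bijective f -> f @` [set` H] = [set` H].

Definition left_cosets (G : groupType) (H : groupClosed G) : set (set G) :=
  [set [set x * h | h in [set` H]] | x in setT].

Definition has_index (G : groupType) (H : groupClosed G) (k : nat) : Prop :=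
  left_cosets H #= `I_k.

Definition is_right_angled_Artin (G : groupType) : Prop :=
  exists (V : finType) (e : rel V),
    [/\ symmetric e, irreflexive e & isomorphic G (right_angled_Artin e)].

(* Main.v *)
Require Import Defs.
From mathcomp Require Import all_boot.
From HB Require Import structures.
From mathcomp Require Import fingroup ssralg ssrint zmodp.
From mathcomp Require Import classical_sets cardinality.

(** Let T = < a, b | a^m b^n = 1 > and c = a^m = b^-n, which is central since it
commutes with both generators.  Killing c turns T into the free product of
Z/m and Z/n, and the kernel of the map from that free product to
Z/m x Z/n is free on the (m-1)(n-1) commutators of the nontrivial powers of a
and b.  So the kernel H of T -> Z/m x Z/n is a central extension of a free
group by < c >, hence Z x F_(m-1)(n-1).

The isomorphism is obtained without the theory of free products, by the
Reidemeister-Schreier method.  Write N for Z x F_(m-1)(n-1), let psi : N -> T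
send the generator of Z to c and the generators of F to the elements
b^j a^i b^-j a^-i with 0 < i < m and 0 < j < n, and take a^i b^j with i < m and
j < n as representatives of the cosets of H.  How right multiplication by a and
b changes the expression psi(x) a^i b^j dictates a right action of T on
N x Z/m x Z/n; [coset_action] constructs this action from the universal property
of T alone.  Following the orbit of the base point (1, 0, 0) shows both that psi
is injective and that every element of T has the form psi(x) a^i b^j; this is
[T_normal_form].  As i and j are the images of that element in Z/m and Z/n,
the image of psi is exactly H and the index of H is mn.

For invariance under automorphisms, first observe that the centre of T lies in
H.  Let a act on Z/m x Z/n by turning the first coordinate where the second
one is 0, and b by turning the second coordinate; a central element commutes
with a, hence preserves the set of points that a moves, hence does not turn
the second coordinate ([skew_commute]).  The other coordinate is symmetric.
Now, for an automorphism f, the composite of f with T -> Z/m x Z/n kills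
commutators, and it kills c because f(c) is central.  It therefore kills
the image of psi, which is H: so f maps H into itself, and so does the inverse
of f. *)

Set Implicit Arguments.
Unset Strict Implicit.
Unset Printing Implicit Defensive.

Local Open Scope group_scope.

(** * Universal properties of presented groups *)

Section Presentations.
Variables (A : choiceType) (R : word A -> word A -> Prop).

Definition gen (x : A) : presented R := word_class R [:: letter x].

Lemma word_class_cat (u v : word A) :
  word_class R (u ++ v) = word_class R u * word_class R v.
Proof.
apply/word_classP/word_equiv_cat; exact/word_equiv_sym/word_equiv_rep.
Qed.

Lemma word_class_flip (l : A * bool) :
  word_class R [:: flip_letter l] = (word_class R [:: l])^-1.
Proof.
apply/esym/mulg1_eq; rewrite -word_class_cat.
by apply/word_classP; apply: (word_equiv_cancel R [::] l [::]).
Qed.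

Lemma word_class_nseq k x : word_class R (nseq k (letter x)) = gen x ^+ k.
Proof.
elim: k => [|k IHk] //=.
by rewrite expgS -IHk -cat1s word_class_cat.
Qed.

Lemma word_class_relation u v : R u v -> word_class R u = word_class R v.
Proof.
move=> Ruv; apply/word_classP.
by rewrite -[u]cats0 -[v]cats0; apply: (word_equiv_relation [::] [::]).
Qed.

Lemma presented_ind (P : presented R -> Prop) :
  P 1 -> (forall x, P (gen x)) -> (forall g h, P g -> P h -> P (g * h)) ->
  (forall g, P g -> P g^-1) -> forall g, P g.
Proof.
move=> P1 Pgen PM PV g; rewrite -(word_repK g).
elim: (word_rep g) => [|l w IHw] //.
rewrite -cat1s word_class_cat; apply: PM IHw.
case: l => x []; last exact: Pgen.
by rewrite (word_class_flip (letter x)); apply: PV; apply: Pgen.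
Qed.

Section Action.
Variables (X : Type) (act act' : A -> X -> X).

Definition act_letter (x : X) (l : A * bool) : X :=
  if l.2 then act' l.1 x else act l.1 x.

Hypothesis actK : forall a, cancel (act a) (act' a).
Hypothesis actVK : forall a, cancel (act' a) (act a).
Hypothesis act_rel : forall u v, R u v ->
  forall x, foldl act_letter x u = foldl act_letter x v.

Lemma act_word_equiv u v : word_equiv R u v ->
  forall x, foldl act_letter x u = foldl act_letter x v.
Proof.
elim=> [//|u' v' _ IH x|u' v' w _ IH1 _ IH2 x|u' [a s] v' x|u' r s v' Rrs x].
- by rewrite IH.
- by rewrite IH1 IH2.
- rewrite !foldl_cat /=; congr foldl.
  by case: s; rewrite /act_letter /= ?actK ?actVK.
- by rewrite !foldl_cat (act_rel Rrs).
Qed.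

(** Words act letter by letter, and equivalent words act alike: cancellation is
harmless because the generators act by bijections. *)
Lemma presented_action : exists rho : X -> presented R -> X,
  [/\ forall x, rho x 1 = x,
      forall x g h, rho x (g * h) = rho (rho x g) h
    & forall x a, rho x (gen a) = act a x].
Proof.
exists (fun x g => foldl act_letter x (word_rep g)).
have repE w x :
    foldl act_letter x (word_rep (word_class R w)) = foldl act_letter x w.
  exact/act_word_equiv/word_equiv_rep.
split=> [x|x g h|x a]; rewrite ?repE ?foldl_cat //.
Qed.

End Action.

(** A morphism to G is obtained from the action of the presented group on the
set G by right multiplications: its value at g is the place where g moves 1. *)
Lemma presented_morphism (G : groupType) (f : A -> G) :
  let val_letter l := if l.2 then (f l.1)^-1 else f l.1 in
  (forall u v, R u v ->
     \prod_(l <- u) val_letter l = \prod_(l <- v) val_letter l) ->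
  exists h : {multiplicative presented R -> G}, forall a, h (gen a) = f a.
Proof.
move=> val_letter fR.
pose act a (x : G) := x * f a; pose act' a (x : G) := x * (f a)^-1.
have actE w x :
    foldl (act_letter act act') x w = x * \prod_(l <- w) val_letter l.
  elim: w x => [|[a s] w IHw] x /=; first by rewrite big_nil mulg1.
  by rewrite IHw big_cons mulgA; case: s.
have [a x|a x|u v Ruv x|rho [rho1 rhoM rho_gen]] :=
  @presented_action G act act'.
- exact: mulgK.
- exact: mulgVK.
- by rewrite !actE (fR _ _ Ruv).
have rhoE g : forall x, rho x g = x * rho 1 g.
  elim/presented_ind: g => [x|a x|g h IHg IHh x|g IHg x].
  - by rewrite !rho1 mulg1.
  - by rewrite !rho_gen /act mul1g.
  - by rewrite !rhoM IHh IHg [in RHS]IHh mulgA.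
  - have rhoV y : rho y g^-1 = y * (rho 1 g)^-1.
      by apply: (mulIg (rho 1 g)); rewrite -IHg -rhoM mulVg rho1 mulgVK.
    by rewrite rhoV [in RHS]rhoV mul1g.
have hM : {morph rho 1 : g h / g * h} by move=> g h; rewrite rhoM rhoE.
pose hmul := isMultiplicative.Build (presented R) G (rho 1) hM.
pose h : {multiplicative presented R -> G} := HB.pack (rho 1) hmul.
by exists h => a; rewrite /= rho_gen /act mul1g.
Qed.

End Presentations.

(** * Group morphisms *)

Section GroupMorphisms.
Variables (G H : groupType) (f : {multiplicative G -> H}).

Lemma morphism1 : f 1 = 1.
Proof. by apply: (mulgI (f 1)); rewrite -gmulfM !mulg1. Qed.

Lemma morphismV : {morph f : x / x^-1}.
Proof. by move=> x; apply/esym/mulg1_eq; rewrite -gmulfM mulgV morphism1. Qed.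

Lemma morphismX k : {morph f : x / x ^+ k}.
Proof.
by move=> x; elim: k => [|k IHk]; rewrite ?morphism1 // !expgS gmulfM IHk.
Qed.

End GroupMorphisms.

Lemma bijective_morphism_inverse (G H : groupType)
    (f : {multiplicative G -> H}) :
  bijective f -> exists2 g : {multiplicative H -> G}, cancel f g & cancel g f.
Proof.
case=> g fK gK.
pose gmul := isMultiplicative.Build H G g (can2_gmulfM fK gK).
by exists (HB.pack g gmul : {multiplicative H -> G}).
Qed.

Lemma isomorphic_subgroup (G N : groupType) (H : groupClosed G)
    (psi : {multiplicative N -> G}) :
  injective psi -> (forall y, psi y \in H) ->
  (forall g, g \in H -> exists y, psi y = g) -> isomorphic (subgroup_type H) N.
Proof.
move=> psi_inj psiH psi_onto.
pose psiS y : subgroup_type H := Sub (psi y) (psiH y).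
have psiSM : {morph psiS : x y / x * y}.
  by move=> x y; apply: val_inj; rewrite valM !SubK gmulfM.
pose pmul := isMultiplicative.Build N (subgroup_type H) psiS psiSM.
pose psiS' : {multiplicative N -> subgroup_type H} := HB.pack psiS pmul.
have psiS_bij : bijective psiS'.
  have onto (x : subgroup_type H) : exists y, psi y == val x.
    by have [y <-] := psi_onto _ (valP x); exists y.
  exists (fun x => xchoose (onto x)) => [y|x].
    by apply: psi_inj; apply/eqP; exact: (xchooseP (onto (psiS y))).
  by apply: val_inj; apply/eqP; exact: (xchooseP (onto x)).
have [r rK psiK] := bijective_morphism_inverse psiS_bij.
by exists r; exists psiS'.
Qed.

(** * The product of the integers and a free group *)

Section IntegerPower.
Variables (G : groupType) (c : G).

Definition zexp (z : Zgroup) : G :=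
  match z with Posz n => c ^+ n | Negz n => c ^- n.+1 end.

Lemma zexpS (z : int) : zexp (z + 1)%R = zexp z * c.
Proof.
case: z => [n|[|n]].
- by rewrite -PoszD /= addn1 expgSr.
- by rewrite /= expg1 mulVg.
- have -> : (Negz n.+1 + 1 = Negz n)%R.
    by rewrite !NegzE -addn1 PoszD GRing.opprD GRing.addrNK.
  by rewrite /= [c ^+ n.+2]expgS invMg mulgVK.
Qed.

Lemma zexpM : {morph zexp : y z / y * z}.
Proof.
move=> y z; rewrite -[y * z]/(GRing.add (y : int) (z : int)).
elim/int_rect: (z : int) => [|n IHn|n IHn].
- by rewrite GRing.addr0 mulg1.
- by rewrite -addn1 PoszD GRing.addrA zexpS IHn zexpS mulgA.
- apply: (mulIg c); rewrite -mulgA -!zexpS -GRing.addrA.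
  by rewrite -addn1 PoszD GRing.opprD !GRing.addrNK.
Qed.

End IntegerPower.

Section IntegersTimesFree.
Variable r : nat.
Local Notation ZF := (Zgroup * free_group r)%type.

Definition zgen : ZF := ((1%R : int), 1).
Definition fgen (k : 'I_r) : ZF := (1, gen _ k).

Lemma ZF_ind (P : ZF -> Prop) :
  P zgen -> (forall k, P (fgen k)) -> (forall g h, P g -> P h -> P (g * h)) ->
  (forall g, P g -> P g^-1) -> forall g, P g.
Proof.
move=> Pz Pf PM PV [z w].
have P1 : P 1 by rewrite -(mulgV zgen); apply: PM => //; apply: PV.
have -> : (z, w) = ((z, 1) : ZF) * (1, w).
  by congr pair; rewrite /= ?mulg1 ?mul1g.
apply: (PM).
  elim/int_rect: (z : int) => [//|n IHn|n IHn].
  - rewrite -addn1 PoszD; have := PM _ _ IHn Pz.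
    by congr P; congr pair; rewrite mulg1.
  - rewrite -addn1 PoszD GRing.opprD; have:= PM _ _ IHn (PV _ Pz).
    by congr P; congr pair; rewrite /= mul1g invg1.
elim/presented_ind: w => [//|k|g h IHg IHh|g IHg]; first exact: Pf.
- by have:= PM _ _ IHg IHh; congr P; congr pair; rewrite mulg1.
- by have:= PV _ IHg; congr P; congr pair; rewrite invg1.
Qed.

Lemma ZF_morphism (G : groupType) (c : G) (s : 'I_r -> G) :
  (forall k, commute c (s k)) ->
  exists psi : {multiplicative ZF -> G},
    psi zgen = c /\ forall k, psi (fgen k) = s k.
Proof.
move=> cs.
have [//|phi phi_gen] :=
  @presented_morphism _ (fun _ _ : word 'I_r => False) G s.
have cphi w : commute c (phi w).
  elim/presented_ind: w => [|k|g h IHg IHh|g IHg].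
  - rewrite morphism1; exact: commute1.
  - by rewrite phi_gen.
  - by rewrite gmulfM; apply: commuteM.
  - by rewrite morphismV; apply: commuteV.
have zphi z w : commute (zexp c z) (phi w).
  apply/commute_sym; case: z => n /=; [|apply: commuteV];
  exact/commuteX/commute_sym.
pose f (x : ZF) := zexp c x.1 * phi x.2.
have fM : {morph f : x y / x * y}.
  move=> [x v] [y w]; rewrite /f /= zexpM gmulfM !mulgA; congr (_ * _).
  by rewrite -!mulgA; congr (_ * _); apply: zphi.
pose fmul := isMultiplicative.Build ZF G f fM.
exists (HB.pack f fmul : {multiplicative ZF -> G}).
split=> [|k]; rewrite /= /f /=; first by rewrite morphism1 mulg1.
by rewrite phi_gen mul1g.
Qed.

(** The graph is a star: its centre [None] gives the factor Z, and the leaves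
generate the free group. *)
Lemma ZF_right_angled_Artin : is_right_angled_Artin ZF.
Proof.
pose e : rel (option 'I_r) := fun x y => (x == None) (+) (y == None).
exists (option 'I_r), e; split=> [x y|x|]; rewrite /e ?addbb //.
  exact: addbC.
pose RA (u v : word (option 'I_r)) := exists x y : option 'I_r,
    [/\ e x y, u = [:: letter x; letter y] & v = [:: letter y; letter x]].
have comm k : commute (gen RA None) (gen RA (Some k)).
  rewrite /commute -!word_class_cat; apply: word_class_relation.
  by exists None, (Some k).
have [psi [psi_z psi_f]] := ZF_morphism comm.
pose f (x : option 'I_r) : ZF := if x is Some k then fgen k else zgen.
have [u v [x [y [exy -> ->]]]|phi phi_gen] := @presented_morphism _ RA ZF f.
  rewrite !big_cons !big_nil !mulg1 /=.
  have zf k : zgen * fgen k = fgen k * zgen.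
    by congr pair; rewrite /= mulg1 mul1g.
  by case: x y exy => [k|] [l|] //= _; rewrite zf.
exists psi, phi => g.
  elim/ZF_ind: g => [|k|g h IHg IHh|g IHg].
  - by rewrite psi_z phi_gen.
  - by rewrite psi_f phi_gen.
  - by rewrite !gmulfM IHg IHh.
  - by rewrite !morphismV IHg.
elim/presented_ind: g => [|k|g h IHg IHh|g IHg].
- by rewrite !morphism1.
- by rewrite phi_gen; case: k => [k|] /=; rewrite ?psi_z ?psi_f.
- by rewrite !gmulfM IHg IHh.
- by rewrite !morphismV IHg.
Qed.

End IntegersTimesFree.

(** * Rotations of cyclic sets with a counter of turns *)

Lemma inord0 k : inord 0 = ord0 :> 'I_k.+1.
Proof. by apply: val_inj; rewrite /= inordK. Qed.

Lemma ordS_inord k d : d < k -> ordS (inord d) = inord d.+1 :> 'I_k.+1.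
Proof.
by move=> dk; apply: val_inj; rewrite /= !inordK ?modn_small // ltnS ltnW.
Qed.

Lemma ordS_max k : ordS ord_max = ord0 :> 'I_k.+1.
Proof. by apply: val_inj; rewrite /= modnn. Qed.

Lemma inord_eq_max k d : d < k -> (inord d == ord_max :> 'I_k.+1) = false.
Proof.
move=> dk; rewrite -val_eqE /= inordK ?(ltn_eqF dk) //.
by rewrite ltnS ltnW.
Qed.

Section Rotation.
Variables (N : groupType) (k : nat) (c : N).
Implicit Types y : N * 'I_k.+1.

(** If N is Z and c its generator 1, then a pair is an integer written as its
quotient and remainder by k + 1, and this is the successor function. *)
Definition odometer y :=
  (y.1 * (if y.2 == ord_max then c else 1), ordS y.2).
Definition odometerV y :=
  (y.1 * (if ord_pred y.2 == ord_max then c else 1)^-1, ord_pred y.2).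

Lemma odometerK : cancel odometer odometerV.
Proof. by case=> x i; rewrite /odometer /odometerV /= ordSK mulgK. Qed.

Lemma odometerVK : cancel odometerV odometer.
Proof. by case=> x i; rewrite /odometer /odometerV /= ord_predK mulgVK. Qed.

Lemma iter_odometer0 x d : d <= k -> iter d odometer (x, ord0) = (x, inord d).
Proof.
elim: d => [_|d IHd dk]; first by rewrite inord0.
by rewrite iterS (IHd (ltnW dk)) /odometer /= inord_eq_max // mulg1 ordS_inord.
Qed.

Lemma iter_odometer y : iter k.+1 odometer y = (y.1 * c, y.2).
Proof.
(* A full turn commutes with partial turns, so starting at 0 is enough. *)
have turn x : iter k.+1 odometer (x, ord0) = (x * c, ord0).
  rewrite iterS iter_odometer0 // /odometer /=.
  have -> : inord k = ord_max :> 'I_k.+1 by apply: val_inj; rewrite /= inordK.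
  by rewrite eqxx ordS_max.
case: y => x i; have ik : i <= k by rewrite -ltnS.
have iterE z : (z, i) = iter i odometer (z, ord0).
  by rewrite iter_odometer0 // inord_val.
by rewrite {1}iterE -iterD addnC iterD turn -iterE.
Qed.

End Rotation.

Lemma iter_ordS k (i : 'I_k.+1) : iter k.+1 (@ordS _) i = i.
Proof.
have iter2 d (y : Zgroup * 'I_k.+1) :
    (iter d (odometer 1) y).2 = iter d (@ordS _) y.2.
  by elim: d => //= d ->.
by rewrite -(iter2 k.+1 (1, i)) iter_odometer.
Qed.

(** * Actions and morphisms of T *)

Section UniversalProperties.
Variables m n : nat.
Local Notation T := (T_group m n).

Definition Ta : T := gen _ ord0.
Definition Tb : T := gen _ ord_max.

Lemma T_ind (P : T -> Prop) :
  P Ta -> P Tb -> (forall g h, P g -> P h -> P (g * h)) ->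
  (forall g, P g -> P g^-1) -> forall g, P g.
Proof.
move=> Pa Pb PM PV; apply: presented_ind => // [|k].
  by rewrite -(mulgV Ta); apply: (PM) => //; apply: PV.
case: (unliftP ord_max k) => [j|] -> //.
by rewrite (ord1 j) (_ : lift _ _ = ord0) //; apply: val_inj.
Qed.

Lemma T_relation : Ta ^+ m * Tb ^+ n = 1.
Proof.
by rewrite -!word_class_nseq -word_class_cat; apply: word_class_relation.
Qed.

Lemma T_action (X : Type) (A A' B B' : X -> X) :
  cancel A A' -> cancel A' A -> cancel B B' -> cancel B' B ->
  (forall x, iter n B (iter m A x) = x) ->
  exists rho : X -> T -> X,
  [/\ forall x, rho x 1 = x,
      forall x g h, rho x (g * h) = rho (rho x g) h,
      forall x, rho x Ta = A x & forall x, rho x Tb = B x].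
Proof.
move=> AK AVK BK BVK AB1.
pose act (a : 'I_2) := if a == ord0 then A else B.
pose act' (a : 'I_2) := if a == ord0 then A' else B'.
have foldl_nseq k l x :
    foldl (act_letter act act') x (nseq k l) =
      iter k ((act_letter act act')^~ l) x.
  by elim: k x => // k IHk x; rewrite iterSr -IHk.
have [a|a|u v [-> ->] x|rho [rho1 rhoM rho_gen]] := @presented_action _
    (fun u v : word 'I_2 =>
       u = nseq m (letter ord0) ++ nseq n (letter ord_max) /\ v = [::])
    X act act'.
- by rewrite /act /act'; case: ifP.
- by rewrite /act /act'; case: ifP.
- by rewrite foldl_cat !foldl_nseq; apply: AB1.
- by exists rho; split=> // x; rewrite rho_gen.
Qed.

Lemma T_morphism (G : groupType) (alpha beta : G) :
  alpha ^+ m * beta ^+ n = 1 ->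
  exists h : {multiplicative T -> G}, h Ta = alpha /\ h Tb = beta.
Proof.
move=> rel.
pose f (x : 'I_2) := if x == ord0 then alpha else beta.
have [u v [-> ->]|h h_gen] := @presented_morphism _
    (fun u v : word 'I_2 =>
       u = nseq m (letter ord0) ++ nseq n (letter ord_max) /\ v = [::]) G f.
  by rewrite big_cat !big_nseq !iter_mulg_1 big_nil.
by exists h; rewrite !h_gen.
Qed.

(** Equivariance passes from the generators to products, and to inverses by
cancellation.  With chi the identity, it is equivariance for the action of T on
itself by right multiplication. *)
Lemma T_action_over (X : Type) (C : groupType) (rho : X -> T -> X) (pi : X -> C)
    (chi : {multiplicative T -> C}) :
  (forall x, rho x 1 = x) -> (forall x g h, rho x (g * h) = rho (rho x g) h) ->
  (forall x, pi (rho x Ta) = pi x * chi Ta) ->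
  (forall x, pi (rho x Tb) = pi x * chi Tb) ->
  forall x g, pi (rho x g) = pi x * chi g.
Proof.
move=> rho1 rhoM pia pib x g; elim/T_ind: g x => // [g h IHg IHh x|g IHg x].
  by rewrite rhoM IHh IHg gmulfM mulgA.
by apply: (mulIg (chi g)); rewrite -IHg -rhoM mulVg rho1 morphismV mulgVK.
Qed.

End UniversalProperties.

Arguments Ta {m n}.
Arguments Tb {m n}.

(** The relation makes a^m equal to b^-n, so it commutes with both generators. *)
Lemma Ta_expn_commute m n (g : T_group m n) : commute (Ta ^+ m) g.
Proof.
have aE : Ta ^+ m = Tb ^- n :> T_group m n.
  by apply: invg_inj; rewrite invgK; apply/mulg1_eq/T_relation.
elim/T_ind: g => [||g h IHg IHh|g IHg].
- exact/commute_sym/commuteX/commute_refl.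
- by rewrite aE; apply/commute_sym/commuteV/commuteX/commute_refl.
- exact: commuteM.
- exact: commuteV.
Qed.

Lemma ord_mul_bij (p q : nat) :
  exists e : 'I_p * 'I_q -> 'I_(p * q), bijective e.
Proof.
have eqpq : #|{: 'I_p * 'I_q}| = (p * q)%N by rewrite card_prod !card_ord.
exists (fun x => cast_ord eqpq (enum_rank x)).
exists (fun k => enum_val (cast_ord (esym eqpq) k)) => x.
  by rewrite cast_ordK enum_rankK.
by rewrite enum_valK cast_ordKV.
Qed.

(** * The normal form of the elements of T *)

Section CosetAction.
Variables (N : groupType) (p q : nat).
Variables (c : N) (P : 'I_p.+1 -> 'I_q.+1 -> N).
Hypothesis cP : forall i j, commute c (P i j).
Local Notation X := (N * 'I_p.+1 * 'I_q.+1)%type.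

(** The triple (x, i, j) stands for x a^i b^j, where c = a^m and P i j plays the
role of b^j a^i b^-j a^-i.  In these coordinates b is a mere rotation of j, with
c^-1 = b^n picked up at each turn.  In the coordinates x b^j a^i it is a that is
a rotation, of i; dividing by P i j before this rotation and multiplying by
P (i + 1) j after it translates between the two.  Hence a^m and b^n act as
multiplications by c and c^-1, for any elements P i j commuting with c. *)
Lemma coset_action : exists rho : X -> T_group p.+1 q.+1 -> X,
  [/\ forall x, rho x 1 = x,
      forall x g h, rho x (g * h) = rho (rho x g) h,
      forall x i j, rho (x, i, j) Ta =
        (x / P i j * (if i == ord_max then c else 1) * P (ordS i) j, ordS i, j)
    & forall x i j, rho (x, i, j) Tb =
        (x * (if j == ord_max then c^-1 else 1), i, ordS j)].
Proof.
pose A_ (f : N * 'I_p.+1 -> N * 'I_p.+1) (t : X) : X :=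
  let y := f (t.1.1 / P t.1.2 t.2, t.1.2) in (y.1 * P y.2 t.2, y.2, t.2).
pose B_ (f : N * 'I_q.+1 -> N * 'I_q.+1) (t : X) : X :=
  let y := f (t.1.1, t.2) in (y.1, t.1.2, y.2).
have A_K f f' : cancel f f' -> cancel (A_ f) (A_ f').
  by move=> fK [[x i] j]; rewrite /A_ /= mulgK -surjective_pairing fK /= mulgVK.
have B_K f f' : cancel f f' -> cancel (B_ f) (B_ f').
  by move=> fK [[x i] j]; rewrite /B_ /= -surjective_pairing fK.
have iterA f k t : iter k (A_ f) t = A_ (iter k f) t.
  elim: k t => [[[x i] j]|k IHk t]; first by rewrite /A_ /= mulgVK.
  by rewrite iterS IHk /A_ /= mulgK -surjective_pairing.
have iterB f k t : iter k (B_ f) t = B_ (iter k f) t.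
  elim: k t => [[[x i] j] //|k IHk t].
  by rewrite iterS IHk /B_ /= -surjective_pairing.
have [| | | |[[x i] j]|rho [rho1 rhoM rho_a rho_b]] :=
    @T_action p.+1 q.+1 X (A_ (odometer c)) (A_ (odometerV c))
      (B_ (odometer c^-1)) (B_ (odometerV c^-1)).
- exact/A_K/odometerK.
- exact/A_K/odometerVK.
- exact/B_K/odometerK.
- exact/B_K/odometerVK.
- rewrite iterA iterB /A_ iter_odometer /= /B_ iter_odometer /= -(mulgA _ c) cP.
  by rewrite mulgA mulgVK mulgK.
by exists rho.
Qed.

End CosetAction.

(** Let theta send (x, i, j) to psi(x) a^i b^j.  It is equivariant for
[coset_action] and right multiplication, so each g is theta of the point where g
moves the base point (1, 0, 0).  Conversely psi(y) moves (1, 0, 0) to (y, 0, 0),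
which gives injectivity. *)
Lemma T_normal_form (p q : nat) :
  let T := T_group p.+1 q.+1 in
  exists psi : {multiplicative Zgroup * free_group (p * q) -> T},
  [/\ psi (zgen _) = Ta ^+ p.+1,
      forall k, exists i j,
        psi (fgen k) = Tb ^+ j * Ta ^+ i * Tb ^- j * Ta ^- i,
      injective psi
    & forall g, exists x (i : 'I_p.+1) (j : 'I_q.+1),
        g = psi x * Ta ^+ i * Tb ^+ j].
Proof.
move=> T; set N := (Zgroup * free_group (p * q))%type.
have [e [d eK dK]] := ord_mul_bij p q.
pose comm (i j : nat) : T := Tb ^+ j * Ta ^+ i * Tb ^- j * Ta ^- i.
have [k|psi [psi_z psi_f]] := @ZF_morphism (p * q) T (Ta ^+ p.+1)
    (fun k => comm (d k).1.+1 (d k).2.+1); first exact: Ta_expn_commute.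
pose c : N := zgen _.
pose P (i : 'I_p.+1) (j : 'I_q.+1) : N :=
  if unlift ord0 i is Some i' then
    if unlift ord0 j is Some j' then fgen (e (i', j')) else 1 else 1.
have P0j j : P ord0 j = 1 by rewrite /P unlift_none.
have Pi0 i : P i ord0 = 1 by rewrite /P unlift_none; case: unlift.
have psiP i j : psi (P i j) = comm i j.
  rewrite /P; case: unliftP => [i'|] ->; last first.
    by rewrite morphism1 /comm expg0 mulg1 mulgV invg1 mulg1.
  case: unliftP => [j'|] ->; last first.
    by rewrite morphism1 /comm expg0 invg1 mulg1 mul1g mulgV.
  by rewrite psi_f eK.
have cP i j : commute c (P i j).
  rewrite /P; case: unlift => [i'|]; last exact: commute1.
  case: unlift => [j'|]; last exact: commute1.
  by congr pair; rewrite /= mulg1 mul1g.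
have [rho [rho1 rhoM rho_a rho_b]] := coset_action cP.
pose theta (t : N * 'I_p.+1 * 'I_q.+1) : T :=
  psi t.1.1 * Ta ^+ t.1.2 * Tb ^+ t.2.
(* At the last index the representative wraps around to 1, and a full power
   splits off. *)
have wrap (k : nat) (i : 'I_k.+1) (g : T) :
    g ^+ i * g = (if i == ord_max then g ^+ k.+1 else 1) * g ^+ (ordS i).
  rewrite -expgSr; case: eqP => [->|/eqP ik] /=; first by rewrite modnn mulg1.
  rewrite mul1g modn_small // ltnS ltn_neqAle -ltnS ltn_ord andbT.
  by move: ik; rewrite -val_eqE.
have bqE : Tb ^+ q.+1 = (Ta ^+ p.+1)^-1 :> T.
  by apply/esym/mulg1_eq/T_relation.
have swap k l : psi (P k l) * (Ta ^+ k * Tb ^+ l) = Tb ^+ l * Ta ^+ k.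
  by rewrite psiP /comm mulgA !mulgVK.
have thetaM : forall t g, theta (rho t g) = theta t * g.
  apply: (T_action_over (chi := idfun) rho1 rhoM) => -[[x i] j] /=.
  - have psi_w : psi (if i == ord_max then c else 1) =
        if i == ord_max then Ta ^+ p.+1 else 1.
      by case: eqP => _; rewrite ?morphism1.
    have wC h : commute (if i == ord_max then Ta ^+ p.+1 else 1) (h : T).
      by case: eqP => _; [apply: Ta_expn_commute | apply/commute_sym/commute1].
    rewrite rho_a /theta /= !gmulfM morphismV psi_w -!mulgA swap.
    rewrite (mulgA _ (Tb ^+ j)) wC -mulgA -wrap [Tb ^+ j * _]mulgA -swap.
    by rewrite -(mulgA _ _ Ta) mulKg -(mulgA _ _ Ta).
  - have psi_w : psi (if j == ord_max then c^-1 else 1) =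
        if j == ord_max then Tb ^+ q.+1 else 1.
      by case: eqP => _; rewrite ?morphism1 // bqE morphismV psi_z.
    have wC h : commute (h : T) (if j == ord_max then Tb ^+ q.+1 else 1).
      case: eqP => _; last exact: commute1.
      by rewrite bqE; apply/commuteV/commute_sym/Ta_expn_commute.
    rewrite rho_b /theta /= gmulfM psi_w -[RHS]mulgA wrap !mulgA.
    by rewrite -(mulgA _ _ (Ta ^+ i)) -wC !mulgA.
(* From (x, 0, 0), the word b^j a^i b^-j a^-i passes through (x, 0, j), then
   (x (P i j), i, j), then (x (P i j), i, 0), and ends at (x (P i j), 0, 0). *)
have rho_aX k x j : k < p.+1 ->
    rho (x, ord0, j) (Ta ^+ k) = (x * P (inord k) j, inord k, j).
  elim: k => [_|k IHk ltkp]; first by rewrite inord0 expg0 rho1 P0j mulg1.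
  rewrite expgSr rhoM (IHk (ltnW ltkp)) rho_a mulgK.
  by rewrite inord_eq_max // mulg1 ordS_inord.
have rho_bX k x i : k < q.+1 -> rho (x, i, ord0) (Tb ^+ k) = (x, i, inord k).
  elim: k => [_|k IHk ltkq]; first by rewrite inord0 expg0 rho1.
  rewrite expgSr rhoM (IHk (ltnW ltkq)) rho_b.
  by rewrite inord_eq_max // mulg1 ordS_inord.
have rhoV t t' g : rho t g = t' -> rho t' g^-1 = t.
  by move=> <-; rewrite -rhoM mulgV rho1.
have rho_psi y : forall x, rho (x, ord0, ord0) (psi y) = (x * y, ord0, ord0).
  elim/ZF_ind: y => [x|k x|g h IHg IHh x|g IHg x].
  - have -> : psi (zgen _) = Ta ^+ p * Ta by rewrite psi_z expgSr.
    have pE : inord p = ord_max :> 'I_p.+1 by apply: val_inj; rewrite /= inordK.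
    by rewrite rhoM rho_aX // pE rho_a mulgK eqxx ordS_max P0j mulg1.
  - have [i' [j' ij]] : exists i' j', fgen k = P (lift ord0 i') (lift ord0 j').
      by exists (d k).1, (d k).2; rewrite /P !liftK -surjective_pairing dK.
    rewrite ij psiP /comm !rhoM rho_bX // rho_aX // !inord_val.
    set i := lift ord0 i'; set j := lift ord0 j'.
    have -> : rho (x * P i j, i, j) (Tb ^- j) = (x * P i j, i, ord0).
      by apply: rhoV; rewrite rho_bX // inord_val.
    by apply: rhoV; rewrite rho_aX // inord_val Pi0 mulg1.
  - by rewrite gmulfM rhoM IHg IHh mulgA.
  - by rewrite morphismV; apply: rhoV; rewrite IHg mulgVK.
exists psi; split=> // [k|x y psixy|g].
- by exists (d k).1.+1, (d k).2.+1; apply: psi_f.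
- have := congr1 (fun g => (rho (1, ord0, ord0) g).1.1) psixy.
  by rewrite !rho_psi !mul1g.
have := thetaM (1, ord0, ord0) g.
case: (rho _ g) => [[x i] j]; rewrite {2}/theta /= morphism1 expg0 !mul1g.
by move=> <-; exists x, i, j.
Qed.

(** * The centre of T *)

Definition ord_unit k : 'I_k.+1 := inZp 1.

Lemma ordS_mulg k (i : 'I_k.+1) : ordS i = i * ord_unit k.
Proof. by apply: val_inj; rewrite /= modnDmr addn1. Qed.

Lemma ord_unit_expg k (i : 'I_k.+1) : ord_unit k ^+ i = i.
Proof.
by rewrite Zp_expg; apply: val_inj; rewrite /= modnMml mul1n modn_small.
Qed.

Lemma ord_unit_expn k : ord_unit k ^+ k.+1 = 1.
Proof. by rewrite Zp_expg; apply: val_inj; rewrite /= modnMl. Qed.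

Lemma ord_mulgC k (i j : 'I_k.+1) : commute i j.
Proof. exact: Zp_mulgC. Qed.

Section SkewRotation.
Variables k l : nat.
Local Notation X := ('I_k.+1 * 'I_l.+1)%type.

Definition rotate (s : 'I_l.+1 -> 'I_l.+1) (t : X) : X := (t.1, s t.2).
Definition skew (s : 'I_k.+1 -> 'I_k.+1) (t : X) : X :=
  (if t.2 == ord0 then s t.1 else t.1, t.2).

Lemma rotate_can s s' : cancel s s' -> cancel (rotate s) (rotate s').
Proof. by move=> sK [u v]; rewrite /rotate /= sK. Qed.

Lemma skew_can s s' : cancel s s' -> cancel (skew s) (skew s').
Proof. by move=> sK [u v]; rewrite /skew /=; case: (v == _); rewrite ?sK. Qed.

Lemma iter_rotate t : iter l.+1 (rotate (@ordS _)) t = t.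
Proof.
have iterE d : iter d (rotate (@ordS _)) t = rotate (iter d (@ordS _)) t.
  by elim: d => [|d IHd]; rewrite ?iterS ?IHd //; case: t.
by rewrite iterE /rotate iter_ordS -surjective_pairing.
Qed.

Lemma iter_skew t : iter k.+1 (skew (@ordS _)) t = t.
Proof.
have iterE d : iter d (skew (@ordS _)) t = skew (iter d (@ordS _)) t.
  elim: d => [|d IHd]; first by rewrite /skew /= if_same; case: t.
  by rewrite iterS IHd /skew /=; case: (t.2 == _).
by rewrite iterE /skew iter_ordS if_same -surjective_pairing.
Qed.

(** Otherwise z would move the point (0, 0) to a point where g acts trivially;
as g commutes with z, it would fix (0, 0), which it turns to (1, 0). *)
Lemma skew_commute (G : groupType) (rho : X -> G -> X) (chi : G -> 'I_l.+1)
    g z :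
  0 < k ->
  (forall x, rho x 1 = x) -> (forall x g h, rho x (g * h) = rho (rho x g) h) ->
  (forall t h, (rho t h).2 = t.2 * chi h) ->
  (forall t, rho t g = skew (@ordS _) t) ->
  commute g z -> chi z = 1.
Proof.
move=> k_gt0 rho1 rhoM rho2 rho_g gz; pose o : X := (ord0, ord0).
have [z0|z_neq0] := eqVneq (chi z) 1; first by [].
have fix_oz : rho (rho o z) g = rho o z.
  rewrite rho_g /skew rho2 mul1g (negPf z_neq0).
  by rewrite [RHS]surjective_pairing rho2 mul1g.
have : rho o g = o.
  move: fix_oz; rewrite -rhoM -gz rhoM => /(congr1 (rho^~ z^-1)).
  by rewrite -(rhoM (rho o g)) -(rhoM o z) mulgV !rho1.
by rewrite rho_g /skew => /(congr1 fst) /(congr1 val); rewrite /= modn_small.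
Qed.

End SkewRotation.

Section Center.
Variables p q : nat.
Local Notation T := (T_group p.+1 q.+1).

Lemma T_to_cyclic :
  exists (chi1 : {multiplicative T -> 'I_p.+1})
         (chi2 : {multiplicative T -> 'I_q.+1}),
  [/\ chi1 Ta = ord_unit p, chi1 Tb = 1, chi2 Ta = 1 & chi2 Tb = ord_unit q].
Proof.
have [|chi1 [chi1a chi1b]] := @T_morphism p.+1 q.+1 'I_p.+1 (ord_unit p) 1.
  by rewrite monoid.expg1n mulg1 ord_unit_expn.
have [|chi2 [chi2a chi2b]] := @T_morphism p.+1 q.+1 'I_q.+1 1 (ord_unit q).
  by rewrite monoid.expg1n mul1g ord_unit_expn.
by exists chi1, chi2.
Qed.

Variable chi1 : {multiplicative T -> 'I_p.+1}.
Variable chi2 : {multiplicative T -> 'I_q.+1}.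
Hypotheses (chi1a : chi1 Ta = ord_unit p) (chi1b : chi1 Tb = 1).
Hypotheses (chi2a : chi2 Ta = 1) (chi2b : chi2 Tb = ord_unit q).

Lemma T_center_chi2 z : 0 < p -> (forall g, commute g z) -> chi2 z = 1.
Proof.
move=> p_gt0 zC.
have [| | | |t|rho [rho1 rhoM rho_a rho_b]] := @T_action p.+1 q.+1 _
    (@skew p q (@ordS _)) (skew (@ord_pred _))
    (rotate (@ordS _)) (rotate (@ord_pred _)).
- exact/skew_can/ordSK.
- exact/skew_can/ord_predK.
- exact/rotate_can/ordSK.
- exact/rotate_can/ord_predK.
- by rewrite iter_skew iter_rotate.
apply: (skew_commute p_gt0 rho1 rhoM _ rho_a (zC Ta)) => t g.
apply: (T_action_over (pi := snd)) => // x.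
  by rewrite rho_a chi2a mulg1.
by rewrite rho_b chi2b -ordS_mulg.
Qed.

Lemma T_center_chi1 z : 0 < q -> (forall g, commute g z) -> chi1 z = 1.
Proof.
move=> q_gt0 zC.
have [| | | |t|rho [rho1 rhoM rho_a rho_b]] := @T_action p.+1 q.+1 _
    (@rotate q p (@ordS _)) (rotate (@ord_pred _))
    (skew (@ordS _)) (skew (@ord_pred _)).
- exact/rotate_can/ordSK.
- exact/rotate_can/ord_predK.
- exact/skew_can/ordSK.
- exact/skew_can/ord_predK.
- by rewrite iter_rotate iter_skew.
apply: (skew_commute q_gt0 rho1 rhoM _ rho_b (zC Tb)) => t g.
apply: (T_action_over (pi := snd)) => // x.
  by rewrite rho_a chi1a -ordS_mulg.
by rewrite rho_b chi1b mulg1.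
Qed.

End Center.

(** * Index, joint kernels and invariance under automorphisms *)

Lemma morphism_commutator_trivial (G C : groupType)
    (f : {multiplicative G -> C}) (x y : G) :
  commute (f x) (f y) -> f (y * x * y^-1 * x^-1) = 1.
Proof. by move=> xy; rewrite !gmulfM !morphismV -xy mulgK mulgV. Qed.

(** The left cosets of H are the fibers of F. *)
Lemma has_index_fibers (G : groupType) (C : finType) (F : G -> C)
  (H : groupClosed G) :
  (forall c, exists g, F g = c) ->
  (forall g h, (F g = F h) <-> g^-1 * h \in H) ->
  has_index H #|C|.
Proof.
move=> F_onto FH; rewrite /has_index.
pose fiber c : set G := [set g | F g = c]%classic.
have -> : left_cosets H = (fiber @` [set: C])%classic.
  have fiberE g : [set g * h | h in [set` H]]%classic = fiber (F g).
    apply/seteqP; split=> [_ [h hH <-]|h] /=; rewrite /fiber /=.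
      by apply/esym/FH; rewrite mulKg.
    by move/esym/FH=> ghH; exists (g^-1 * h) => //; rewrite mulVKg.
  apply/seteqP; split=> [_ [g _ <-]|_ [c _ <-]].
    by exists (F g) => //; rewrite fiberE.
  by have [g <-] := F_onto c; exists g => //; rewrite fiberE.
have fiber_inj : injective fiber.
  move=> c d; have [g gc] := F_onto c => /(congr1 (fun S => S g)) /= cd.
  by rewrite -gc; have : fiber d g by rewrite -cd.
rewrite (card_eql (inj_card_eq _)); last by apply: in2W.
rewrite (card_eqr card_II).
have -> : [set: C]%classic = (enum_val @` [set: 'I_#|C|])%classic.
  apply/seteqP; split=> // c _.
  by exists (enum_rank c) => //; apply: enum_rankK.
by apply: inj_card_eq; apply: in2W; apply: enum_val_inj.
Qed.

Section JointKernel.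
Variables (G C D : groupType).
Variables (chi1 : {multiplicative G -> C}) (chi2 : {multiplicative G -> D}).

Definition joint_ker : {pred G} := [pred g | (chi1 g == 1) && (chi2 g == 1)].

Fact joint_ker_mul : {in joint_ker &, forall g h, g * h \in joint_ker}.
Proof.
move=> g h /andP[/eqP g1 /eqP g2] /andP[/eqP h1 /eqP h2].
by rewrite inE !gmulfM g1 g2 h1 h2 !mulg1 !eqxx.
Qed.

Fact joint_ker_one : 1 \in joint_ker.
Proof. by rewrite inE !morphism1 !eqxx. Qed.

Fact joint_ker_inv : {in joint_ker, forall g, g^-1 \in joint_ker}.
Proof. by move=> g; rewrite !inE !morphismV !invg_eq1. Qed.

HB.instance Definition _ := isMulClosed.Build G joint_ker joint_ker_mul.
HB.instance Definition _ := isMul1Closed.Build G joint_ker joint_ker_one.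
HB.instance Definition _ := isInvClosed.Build G joint_ker joint_ker_inv.

Definition joint_ker_subgroup : groupClosed G := joint_ker.

Lemma joint_kerP g :
  reflect (chi1 g = 1 /\ chi2 g = 1) (g \in joint_ker_subgroup).
Proof. by rewrite inE; apply: (iffP andP) => -[/eqP ? /eqP]. Qed.

End JointKernel.

Lemma characteristic_stable (G : groupType) (H : groupClosed G) :
  (forall f : {multiplicative G -> G}, bijective f ->
     forall g, g \in H -> f g \in H) ->
  characteristic H.
Proof.
move=> stable f f_bij; have [f' fK f'K] := bijective_morphism_inverse f_bij.
apply/seteqP; split=> [_ [g gH <-]|g gH] /=; first exact: stable.
by exists (f' g); [apply: stable => //; exists f | apply: f'K].
Qed.

(** * The subgroup Z x F *)

Theorem proposition2p1 (m n : nat) (hm : 2 <= m) (hn : 2 <= n) :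
  exists H : groupClosed (T_group m n),
    [/\ characteristic H,
        has_index H (m * n),
        isomorphic (subgroup_type H) (Zgroup * free_group (m.-1 * n.-1))%type
      & is_right_angled_Artin (Zgroup * free_group (m.-1 * n.-1))%type].
Proof.
case: m n hm hn => [//|p] [//|q]; rewrite !ltnS => p_gt0 q_gt0.
have [psi [psi_z psi_f psi_inj normal_form]] := T_normal_form p q.
have [chi1 [chi2 [chi1a chi1b chi2a chi2b]]] := T_to_cyclic p q.
(* The image of psi is generated by c and commutators, so it dies in every
   abelian image of T in which c dies. *)
have ker_psi (C : groupType) (f : {multiplicative T_group p.+1 q.+1 -> C}) :
    (forall x y : C, commute x y) -> f (Ta ^+ p.+1) = 1 ->
    forall y, f (psi y) = 1.
  move=> CC fz; elim/ZF_ind => [|k|g h IHg IHh|g IHg].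
  - by rewrite psi_z.
  - have [i [j ->]] := psi_f k; apply: morphism_commutator_trivial; exact: CC.
  - by rewrite !gmulfM IHg IHh mulg1.
  - by rewrite !morphismV IHg invg1.
pose H := joint_ker_subgroup chi1 chi2.
have center_H z : (forall g, commute g z) -> z \in H.
  move=> zC; apply/joint_kerP.
  by rewrite (T_center_chi1 chi1a chi1b) // (T_center_chi2 chi2a chi2b).
have /joint_kerP[chi1c chi2c] : Ta ^+ p.+1 \in H.
  by apply: center_H => g; apply/commute_sym/Ta_expn_commute.
have psiH y : psi y \in H.
  by apply/joint_kerP; rewrite !ker_psi //; apply: ord_mulgC.
have chi_nf x (i : 'I_p.+1) (j : 'I_q.+1) :
    chi1 (psi x * Ta ^+ i * Tb ^+ j) = i /\
    chi2 (psi x * Ta ^+ i * Tb ^+ j) = j.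
  have /joint_kerP[x1 x2] := psiH x.
  by rewrite !gmulfM !morphismX x1 x2 chi1a chi1b chi2a chi2b !monoid.expg1n
    !ord_unit_expg !mul1g mulg1.
have H_psi g : g \in H -> exists y, psi y = g.
  have [x [i [j ->]]] := normal_form g.
  move/joint_kerP; have [-> ->] := chi_nf x i j => -[-> ->].
  by exists x; rewrite !expg0 !mulg1.
exists H; split; last exact: ZF_right_angled_Artin.
- apply: characteristic_stable => f f_bij _ /H_psi[y <-].
  have /joint_kerP[fc1 fc2] : f (Ta ^+ p.+1) \in H.
    apply: center_H => g; have [f' _ f'K] := f_bij.
    by rewrite -(f'K g); apply/gmulf_commute/commute_sym/Ta_expn_commute.
  apply/joint_kerP; split.
    apply: (ker_psi _ (chi1 \o f : {multiplicative _ -> _})) => //.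
    exact: ord_mulgC.
  apply: (ker_psi _ (chi2 \o f : {multiplicative _ -> _})) => //.
  exact: ord_mulgC.
- have -> : (p.+1 * q.+1)%N = #|{: 'I_p.+1 * 'I_q.+1}|.
    by rewrite card_prod !card_ord.
  apply: (@has_index_fibers _ _ (fun g => (chi1 g, chi2 g))) => [[i j]|g h].
    exists (psi 1 * Ta ^+ i * Tb ^+ j).
    by have [-> ->] := chi_nf 1 i j.
  split=> [[gh1 gh2]|/joint_kerP].
    by apply/joint_kerP; rewrite !gmulfM !morphismV gh1 gh2 !mulVg.
  rewrite !gmulfM !morphismV => -[/mulg1_eq gh1 /mulg1_eq gh2].
  by rewrite -gh1 -gh2 !invgK.
- exact: isomorphic_subgroup psi_inj psiH H_psi.
Qed.
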